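(* Let $p$ be a prime and $P\in\mathbb{Z}[x_1,\ldots,x_n]$. If $P$ is $p$-partition regular, then there exists a minimal (lower) Rado functional $(J_0,\ldots,J_\ell,d_1,\ldots,d_m)$ for $P$ such that, setting $d_0=0$, the equation $$\sum_{i=0}^m p^{d_i}\sum_{\alpha\in J_i}\frac1{\alpha!}\frac{\partial^\alpha P}{\partial x^\alpha}(\boldsymbol 0)\,w^{|\alpha|}=0$$ has an invertible solution $w$ in the ring $\mathbb{Z}_p$ of $p$-adic integers.
   Context: $\mathbb{N}=\{1,2,\ldots\}$, $\mathbb{N}_0=\mathbb{N}\cup\{0\}$. For $P=\sum c_\alpha x^\alpha$, $\mathrm{Supp}(P)=\{\alpha\in\mathbb{N}_0^n:c_\alpha\ne0\}$, $|\alpha|=\sum\alpha_i$, $\alpha!=\prod\alpha_i!$, and $\frac1{\alpha!}\frac{\partial^\alpha P}{\partial x^\alpha}(\boldsymbol 0)=c_\alpha$. $q$-partition regularity ($q\ge2$): $P$ is $q$-partition regular if for every $k\in\mathbb{N}$ and every finite coloring of $\mathbb{N}$ there are infinitely many monochromatic sets $\{a_1,\ldots,a_n\}\subseteq\mathbb{N}$ with $P(a_1,\ldots,a_n)=0$ and $a_1\equiv\cdots\equiv a_n\equiv 0\bmod q^k$. A positive linear map is $\phi(\alpha)=t_1\alpha_1+\cdots+t_n\alpha_n$ with $t_i\in\mathbb{N}_0$; it is $c$-monochromatic if $\{t_1,\ldots,t_n\}$ is. If $M_0<\cdots<M_\ell$ enumerates $\phi(\mathrm{Supp}(P))$, the partition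 determined by $\phi$ is $(J_0,\ldots,J_\ell)$, $J_i=\{\alpha\in\mathrm{Supp}(P):\phi(\alpha)=M_i\}$. A minimal (lower) Rado functional of order $m$ for $P$ is a tuple $(J_0,\ldots,J_\ell,d_1,\ldots,d_m)$, $\ell\ge m$, $d_i\in\mathbb{N}$, such that for every finite coloring $c$ of $\mathbb{N}$ and every $k\in\mathbb{N}$ there are infinitely many $c$-monochromatic positive linear maps $\phi$ determining the partition $(J_0,\ldots,J_\ell)$ with $M_i-M_0=d_i$ ($1\le i\le m$) and $M_{m+1}-M_m\ge k$. *)

(* Defs.v *)
From HB Require Import structures.
From mathcomp Require Import all_boot all_order all_algebra.
From mathcomp Require Import finmap mpoly.
From mathcomp Require Import boolp classical_sets functions cardinality.

Set Implicit Arguments.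
Unset Strict Implicit.
Unset Printing Implicit Defensive.

Import Order.TTheory GRing.Theory Num.Theory.

Local Open Scope classical_set_scope.
Local Open Scope ring_scope.

(* The ring of p-adic integers as the inverse limit of the rings Z/p^k: x k is
   the canonical representative in [0, p^k) of the residue of x modulo p^k.
   (The construction makes sense for any p, but yields the zero ring if p = 1;
   this is why it is only given a comPzRingType structure.) *)
Definition padic_coherent (p : nat) (x : nat -> int) : bool :=
  `[< forall k : nat, x k = (x k.+1 %% p%:Z ^+ k)%Z >].

Record padic_int (p : nat) := PadicInt {
  padic_res :> nat -> int;
  _ : padic_coherent p padic_res }.

HB.instance Definition _ (p : nat) := [isSub for @padic_res p].
HB.instance Definition _ (p : nat) := [Choice of padic_int p by <:].

Section PadicRing.
Variable p : nat.
Implicit Types x y z : padic_int p.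

Lemma padicP x y : (forall k, x k = y k) -> x = y.
Proof. by move=> xy; apply: val_inj; apply: funext. Qed.

Lemma padic_resE x k : x k = (x k.+1 %% p%:Z ^+ k)%Z.
Proof. by case: x => x /= /asboolP; apply. Qed.

Lemma padic_mod x k : (x k %% p%:Z ^+ k)%Z = x k.
Proof. by rewrite padic_resE modz_mod. Qed.

Lemma modz_expS (a : int) k :
  ((a %% p%:Z ^+ k.+1)%Z %% p%:Z ^+ k)%Z = (a %% p%:Z ^+ k)%Z.
Proof.
rewrite {2}(divz_eq a (p%:Z ^+ k.+1)) exprS mulrA -exprS.
by rewrite modzMDl.
Qed.

Lemma padic_coherent_mod (f : nat -> int) :
    (forall k, (f k.+1 %% p%:Z ^+ k)%Z = (f k %% p%:Z ^+ k)%Z) ->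
  padic_coherent p (fun k => (f k %% p%:Z ^+ k)%Z).
Proof. by move=> fP; apply/asboolP => k; rewrite modz_expS fP. Qed.

Fact padic_int_coherent (a : int) :
  padic_coherent p (fun k => (a %% p%:Z ^+ k)%Z).
Proof. exact: padic_coherent_mod. Qed.

Fact padic_opp_coherent x :
  padic_coherent p (fun k => (- x k %% p%:Z ^+ k)%Z).
Proof. by apply: padic_coherent_mod => k; rewrite (padic_resE x k) modzNm. Qed.

Fact padic_add_coherent x y :
  padic_coherent p (fun k => ((x k + y k) %% p%:Z ^+ k)%Z).
Proof.
apply: padic_coherent_mod => k.
by rewrite (padic_resE x k) (padic_resE y k) modzDm.
Qed.

Fact padic_mul_coherent x y :
  padic_coherent p (fun k => ((x k * y k) %% p%:Z ^+ k)%Z).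
Proof.
apply: padic_coherent_mod => k.
by rewrite (padic_resE x k) (padic_resE y k) modzMm.
Qed.

Definition padic_of_int (a : int) := PadicInt (padic_int_coherent a).
Definition padic_opp x := PadicInt (padic_opp_coherent x).
Definition padic_add x y := PadicInt (padic_add_coherent x y).
Definition padic_mul x y := PadicInt (padic_mul_coherent x y).

Fact padic_addA : associative padic_add.
Proof.
by move=> x y z; apply: padicP => k /=; rewrite modzDml modzDmr addrA.
Qed.

Fact padic_addC : commutative padic_add.
Proof. by move=> x y; apply: padicP => k /=; rewrite addrC. Qed.

Fact padic_add0 : left_id (padic_of_int 0) padic_add.
Proof. by move=> x; apply: padicP => k /=; rewrite modzDml add0r padic_mod. Qed.

Fact padic_addN : left_inverse (padic_of_int 0) padic_opp padic_add.
Proof. by move=> x; apply: padicP => k /=; rewrite modzDml addNr. Qed.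

HB.instance Definition _ := GRing.isZmodule.Build (padic_int p)
  padic_addA padic_addC padic_add0 padic_addN.

Fact padic_mulA : associative padic_mul.
Proof.
by move=> x y z; apply: padicP => k /=; rewrite modzMml modzMmr mulrA.
Qed.

Fact padic_mulC : commutative padic_mul.
Proof. by move=> x y; apply: padicP => k /=; rewrite mulrC. Qed.

Fact padic_mul1 : left_id (padic_of_int 1) padic_mul.
Proof. by move=> x; apply: padicP => k /=; rewrite modzMml mul1r padic_mod. Qed.

Fact padic_mulD : left_distributive padic_mul padic_add.
Proof.
by move=> x y z; apply: padicP => k /=; rewrite modzMml modzDm mulrDl.
Qed.

HB.instance Definition _ := GRing.Zmodule_isComPzRing.Build (padic_int p)
  padic_mulA padic_mulC padic_mul1 padic_mulD.

End PadicRing.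

(* The integer (1 / alpha!) (d^alpha P / dx^alpha)(0); the division is exact,
   see taylor_coefE. *)
Definition taylor_coef (n : nat) (P : {mpoly int[n]}) (alpha : 'X_{1..n})
    : int :=
  (P^`M[alpha].@[fun _ => 0] %/ (\prod_(i < n) (alpha i)`!)%N%:Z)%Z.

Lemma taylor_coefE (n : nat) (P : {mpoly int[n]}) (alpha : 'X_{1..n}) :
  taylor_coef P alpha = P@_alpha.
Proof.
rewrite /taylor_coef mevalE.
have -> : \sum_(m <- msupp P^`M[alpha])
    (P^`M[alpha])@_m * \prod_(i < n) (0 : int) ^+ m i = (P^`M[alpha])@_0.
  rewrite (bigID (pred1 0%MM)) /= [X in _ + X]big1; last first.
    move=> m /eqP m0; suff [i mi] : exists i, m i != 0%N.
      by rewrite (bigD1 i) //= expr0n (negPf mi) mul0r mulr0.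
    apply/existsP; apply: contra_notT m0; rewrite negb_exists => /forallP m0.
    by apply/mnmP => i; rewrite mnm0E; apply/eqP; move: (m0 i); rewrite negbK.
  rewrite addr0; have [a0|a0] := boolP (0%MM \in msupp P^`M[alpha]).
    rewrite (big_rem _ a0) /= eqxx [X in _ + X]big1_seq; last first.
      by move=> m /andP[/eqP ->]; rewrite mem_rem_uniqF ?msupp_uniq.
    by rewrite addr0 big1 ?mulr1 // => i _; rewrite mnm0E.
  rewrite (memN_msupp_eq0 a0) big1_seq // => m /andP[/eqP ->].
  by rewrite (negPf a0).
rewrite mcoeff_mderivm addm0 -mulr_natr.
under eq_bigr do rewrite ffactnn.
rewrite natz mulzK // -lt0n; exact: prodn_gt0 (fun i => fact_gt0 _).
Qed.

(* N is {1, 2, ...}: a colouring of N is given by a function on nat whose value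
   at 0 is irrelevant, monochromatic sets being subsets of N. *)
Definition monochromatic (r : nat) (c : nat -> 'I_r) (A : {fset nat}) : Prop :=
  (forall x, x \in A -> (0 < x)%N) /\
  (forall x y, x \in A -> y \in A -> c x = c y).

Definition partition_regular (q n : nat) (P : {mpoly int[n]}) : Prop :=
  forall (k r : nat) (c : nat -> 'I_r), (0 < k)%N ->
  infinite_set [set A : {fset nat} | monochromatic c A /\
    exists a : 'I_n -> nat,
      [/\ A = [fset a i | i : 'I_n]%fset,
          P.@[fun i => (a i)%:Z] = 0
        & forall i, a i = 0 %[mod q ^ k]] ].

(* The positive linear map with coefficients t_1, ..., t_n. *)
Definition plin (n : nat) (t : {ffun 'I_n -> nat}) (alpha : 'X_{1..n}) : nat :=
  (\sum_(i < n) t i * alpha i)%N.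

(* The increasing enumeration M_0 < ... < M_l of phi(Supp P). *)
Definition levels (n : nat) (P : {mpoly int[n]}) (t : {ffun 'I_n -> nat})
    : seq nat :=
  sort leq (undup [seq plin t alpha | alpha <- msupp P]).

Definition level (n : nat) (P : {mpoly int[n]}) (t : {ffun 'I_n -> nat})
  (i : nat) : nat := nth 0%N (levels P t) i.

(* The partition (J_0, ..., J_l) of Supp P determined by phi. *)
Definition level_partition (n : nat) (P : {mpoly int[n]})
    (t : {ffun 'I_n -> nat}) : seq {fset 'X_{1..n}} :=
  [seq [fset alpha in msupp P | plin t alpha == M]%fset | M <- levels P t].

(* The tuple (d_1, ..., d_m) is indexed from 0: d_(i+1) is tnth d i. When m = l
   there is no level M_(m+1), and the gap condition is void. *)
Definition minimal_rado_functional (n : nat) (P : {mpoly int[n]}) (l m : nat)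
    (J : l.+1.-tuple {fset 'X_{1..n}}) (d : m.-tuple nat) : Prop :=
  [/\ (m <= l)%N,
      forall i : 'I_m, (0 < tnth d i)%N
    & forall (r : nat) (c : nat -> 'I_r) (k : nat), (0 < k)%N ->
      infinite_set [set t : {ffun 'I_n -> nat} |
        [/\ monochromatic c [fset t i | i : 'I_n]%fset,
            level_partition P t = J,
            forall i : 'I_m, (level P t i.+1 - level P t 0)%N = tnth d i
          & (m < l)%N -> (k <= level P t m.+1 - level P t m)%N] ] ].

(* Main.v *)
(* Write a solution as a_i = p^(t_i) u_i with u_i prime to p.  Colouring a by
   the colour of v_p(a) together with the residue of its prime-to-p part makes
   t monochromatic and all the u_i congruent to one unit u modulo p^k; the
   equation P(a) = 0 then says that the sum of the P_alpha p^(phi alpha)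
   u^|alpha|, phi being the linear map of t, vanishes modulo p^(M_0 + k).  The
   sets of such (t, u), over all colourings and all k, generate a proper filter.
   Along an ultrafilter G refining it, the partition determined by t is
   constant, and each difference M_i - M_0 is constant or tends to infinity; m
   is the last index before the first unbounded difference.  The levels beyond
   m then disappear modulo every p^k, and w is the p-adic limit of u along G. *)
Require Import Defs.
From mathcomp Require Import all_boot all_order all_algebra.
From mathcomp Require Import finmap mpoly.
From mathcomp Require Import boolp classical_sets cardinality filter.

Import GRing.Theory.

Local Open Scope ring_scope.

Set Implicit Arguments.
Unset Strict Implicit.
Unset Printing Implicit Defensive.

(** * Limits along an ultrafilter *)

Lemma ultra_pigeonhole (T : Type) (V : eqType) (G : set_system T) (f : T -> V)
    (s : seq V) :
  UltraFilter G -> G [set x | f x \in s]%classic ->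
  exists v, G [set x | f x = v]%classic.
Proof.
move=> GU; elim: s => [|v s IHs] Gs; first by have [x] := filter_ex Gs.
have [|Gv] := in_ultra_setVsetC [set x | f x = v]%classic GU; first by exists v.
apply: IHs; apply: filterS (filterI Gs Gv) => x [/=].
by rewrite inE => /orP[/eqP|].
Qed.

Lemma PoszX (m k : nat) : (m ^ k)%:Z = m%:Z ^+ k.
Proof. by rewrite -natz natrX natz. Qed.

(** Modulo each [p^k] the function takes finitely many values, so one residue holds on a set of [G].
    The sets for [k] and [k.+1] meet, and a common point makes the chosen residues coherent. *)
Lemma padic_limit (p : nat) (T : Type) (G : set_system T) (f : T -> int) :
    (0 < p)%N -> UltraFilter G ->
  exists w : padic_int p,
    forall k, G [set x | w k = (f x %% p%:Z ^+ k)%Z]%classic.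
Proof.
move=> p_gt0 GU.
have pk0 k : p%:Z ^+ k != 0 by rewrite expf_neq0 // eqz_nat -lt0n.
have /choice[w wP] k :
    exists a, G [set x | (f x %% p%:Z ^+ k)%Z = a]%classic.
  apply: (ultra_pigeonhole (s := [seq i%:Z | i <- iota 0 (p ^ k)])) => //.
  apply: filterS filterT => x _ /=; apply/mapP.
  exists `|(f x %% p%:Z ^+ k)%Z|%N; last by rewrite gez0_abs ?modz_ge0.
  rewrite mem_iota /= add0n -ltz_nat gez0_abs ?modz_ge0 //.
  by rewrite PoszX ltz_pmod // -PoszX ltz_nat expn_gt0 p_gt0.
have w_coh : padic_coherent p w.
  apply/asboolP => k.
  by have [x [<- <-]] := filter_ex (filterI (wP k) (wP k.+1));
    rewrite modz_expS.
by exists (PadicInt w_coh) => k; apply: filterS (wP k).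
Qed.

(** * Reduction of p-adic integers modulo [p^k] *)

Definition residue_of (p k : nat) (x : padic_int p) (a : int) : Prop :=
  x k = (a %% p%:Z ^+ k)%Z.

Section Residue.
Variables p k : nat.
Implicit Types (x y : padic_int p) (a b : int).

Lemma residue_ofD x y a b :
  residue_of k x a -> residue_of k y b -> residue_of k (x + y) (a + b).
Proof. by rewrite /residue_of /= => -> ->; rewrite modzDm. Qed.

Lemma residue_ofM x y a b :
  residue_of k x a -> residue_of k y b -> residue_of k (x * y) (a * b).
Proof. by rewrite /residue_of /= => -> ->; rewrite modzMm. Qed.

Lemma residue_ofX x a m :
  residue_of k x a -> residue_of k (x ^+ m) (a ^+ m).
Proof.
by move=> xa; elim: m => // m IHm; rewrite !exprS; apply: residue_ofM.
Qed.

Lemma residue_of_nat m : residue_of k (m%:R : padic_int p) m%:Z.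
Proof.
elim: m => [|m IHm]; first by [].
by rewrite -natr1 -addn1 PoszD; apply: residue_ofD.
Qed.

Lemma residue_of_int a : residue_of k (a%:~R : padic_int p) a.
Proof.
case: a => m; first exact: residue_of_nat.
by rewrite /residue_of NegzE mulrNz /= residue_of_nat modzNm.
Qed.

Lemma residue_of_sum (I : Type) (r : seq I) (F : I -> padic_int p)
    (f : I -> int) :
    (forall i, residue_of k (F i) (f i)) ->
  residue_of k (\sum_(i <- r) F i) (\sum_(i <- r) f i).
Proof.
move=> Ff; elim: r => [|i r IHr]; first by rewrite !big_nil.
by rewrite !big_cons; apply: residue_ofD.
Qed.

End Residue.

(** * Levels of a linear map on the support *)

Section Levels.
Variables (n : nat) (P : {mpoly int[n]}) (t : {ffun 'I_n -> nat}).

Lemma mem_levels M :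
  (M \in levels P t) = (M \in [seq plin t alpha | alpha <- msupp P]).
Proof. by rewrite mem_sort mem_undup. Qed.

Lemma levels_sorted : sorted ltn (levels P t).
Proof. by rewrite ltn_sorted_uniq_leq sort_uniq undup_uniq sort_sorted. Qed.

Lemma level_lt (i j : nat) :
  (j < size (levels P t))%N -> (i < j)%N -> (level P t i < level P t j)%N.
Proof.
move=> js ij; apply: (sorted_ltn_nth ltn_trans 0%N levels_sorted) => //.
exact: ltn_trans js.
Qed.

Lemma level0_le alpha : alpha \in msupp P -> (level P t 0 <= plin t alpha)%N.
Proof.
move=> aP; have : plin t alpha \in levels P t by rewrite mem_levels map_f.
by case/(nthP 0%N) => -[|i] i_s <- //; apply/ltnW/level_lt.
Qed.

Lemma big_levels (V : nmodType) (g : 'X_{1..n} -> V) :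
  \sum_(alpha <- msupp P) g alpha = \sum_(M <- levels P t)
    \sum_(alpha <- [fset alpha in msupp P | plin t alpha == M]%fset) g alpha.
Proof.
transitivity (\sum_(alpha <- msupp P)
    \sum_(M <- levels P t | plin t alpha == M) g alpha).
  apply: eq_big_seq => alpha aP.
  have u : uniq (levels P t) by rewrite sort_uniq undup_uniq.
  rewrite big_mkcond (bigD1_seq (plin t alpha)) ?mem_levels ?map_f //= eqxx.
  by rewrite big1 ?addr0 // => M; rewrite eq_sym => /negPf ->.
rewrite (exchange_big_dep predT) //=; apply: eq_bigr => M _.
rewrite -big_filter; apply: perm_big; apply: uniq_perm.
- by rewrite filter_uniq.
- exact: fset_uniq.
by move=> alpha; rewrite mem_filter !inE /= andbC.
Qed.

Lemma nth_level_partition (i : nat) : (i < size (levels P t))%N ->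
  nth fset0 (level_partition P t) i =
    [fset alpha in msupp P | plin t alpha == level P t i]%fset.
Proof. by move=> i_s; rewrite (nth_map 0%N). Qed.

Lemma levels_neq_nil : P <> 0 -> (0 < size (levels P t))%N.
Proof.
move=> P0; have: mlead P \in msupp P by apply: mlead_supp; apply/eqP.
move/(map_f (plin t)); rewrite -mem_levels; by case: levels.
Qed.

End Levels.

(** * Roots modulo powers of [p] *)

Definition approx_root (p n : nat) (P : {mpoly int[n]}) (k : nat)
    (t : {ffun 'I_n -> nat}) (u : int) : bool :=
  (p%:Z ^+ (level P t 0 + k) %|
     \sum_(alpha <- msupp P) P@_alpha * p%:Z ^+ plin t alpha * u ^+ mdeg alpha)%Z.

Lemma dvdz_sum (I : eqType) (r : seq I) (d : int) (F : I -> int) :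
  (forall i, i \in r -> (d %| F i)%Z) -> (d %| \sum_(i <- r) F i)%Z.
Proof. by move=> dF; rewrite big_seq; apply: rpred_sum => i /dF. Qed.

Lemma approx_root_le (p n : nat) (P : {mpoly int[n]}) (k k' : nat)
    (t : {ffun 'I_n -> nat}) (u : int) :
  (k <= k')%N -> approx_root p P k' t u -> approx_root p P k t u.
Proof. by move=> kk'; apply: dvdz_trans; rewrite dvdz_exp2l // leq_add2l. Qed.

(** Grouping the monomials by level gives the sum of [p^(M_i) S_i]. The terms beyond [m] are
    divisible by [p^(M_0 + k)], and [p^(M_0)] is cancelled from the others. *)
Lemma approx_root_levels (p n : nat) (P : {mpoly int[n]}) (k m : nat)
    (d : seq nat) (t : {ffun 'I_n -> nat}) (u : int) :
    (0 < p)%N -> (m < size (levels P t))%N ->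
    (forall i, (i <= m)%N -> level P t i = (level P t 0 + nth 0 (0 :: d) i)%N) ->
    ((m.+1 < size (levels P t))%N -> (level P t 0 + k <= level P t m.+1)%N) ->
    approx_root p P k t u ->
  (p%:Z ^+ k %| \sum_(i < m.+1) (p ^ nth 0%N (0%N :: d) i)%:Z *
     (\sum_(alpha <- nth fset0 (level_partition P t) i)
        taylor_coef P alpha * u ^+ mdeg alpha))%Z.
Proof.
move=> p_gt0 m_lt tM gap; rewrite /approx_root.
set S := fun i => \sum_(alpha <- nth fset0 (level_partition P t) i)
        taylor_coef P alpha * u ^+ mdeg alpha.
have -> : \sum_(alpha <- msupp P)
      P@_alpha * p%:Z ^+ plin t alpha * u ^+ mdeg alpha =
    \sum_(0 <= i < size (levels P t)) p%:Z ^+ level P t i * S i.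
  rewrite (big_levels _ t) (big_nth 0%N) big_nat [RHS]big_nat.
  apply: eq_bigr => i /= i_s; rewrite /S nth_level_partition // mulr_sumr.
  apply: eq_big_seq => alpha; rewrite !inE => /andP[_ /eqP ->].
  by rewrite taylor_coefE [P@_alpha * _]mulrC mulrA.
(* Every level of index above [m] is at least [M_(m+1)], hence at least [M_0 + k]. *)
rewrite (big_cat_nat _ m_lt) //= rpredDr; last first.
  apply: dvdz_sum => i; rewrite mem_index_iota => /andP[mi i_s].
  apply: dvdz_mulr; rewrite dvdz_exp2l //.
  apply: leq_trans (gap (leq_ltn_trans mi i_s)) _.
  move: mi; rewrite leq_eqVlt => /orP[/eqP <-//|mi].
  exact/ltnW/level_lt.
rewrite big_mkord exprD (eq_bigr (fun i : 'I_m.+1 => p%:Z ^+ level P t 0 *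
  ((p ^ nth 0%N (0%N :: d) i)%:Z * S i))); last first.
  by move=> i _; rewrite tM -1?ltnS // exprD PoszX mulrA.
by rewrite -mulr_sumr dvdz_mul2l // expf_neq0 // eqz_nat -lt0n.
Qed.

(** * From partition regularity to approximate solutions *)

(** With no variable the only possible set of values is empty, so there cannot be infinitely
    many. *)
Lemma partition_regular_dim (q n : nat) (P : {mpoly int[n]}) :
  partition_regular q P -> (0 < n)%N.
Proof.
move=> /(_ 1%N 1%N (fun=> ord0) isT); case: n P => // P [].
apply: sub_finite_set (finite_set1 fset0) => A [_ [a [-> _ _]]] /=.
by apply/fsetP => x; rewrite inE; apply/imfsetP => -[[]].
Qed.

Lemma partition_regular_approx (p n : nat) (P : {mpoly int[n]}) (r : nat)
    (c : nat -> 'I_r) (k : nat) :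
    prime p -> partition_regular p P ->
  exists (t : {ffun 'I_n -> nat}) (uv : int * int),
    [/\ forall i, (k < t i)%N, forall i j, c (t i) = c (t j),
        (uv.1 * uv.2 = 1 %[mod p%:Z ^+ k])%Z & approx_root p P k t uv.1].
Proof.
move=> p_pr P_reg; have n_gt0 := partition_regular_dim P_reg.
have p_gt0 := prime_gt0 p_pr.
have pk_gt0 : (0 < p ^ k)%N by rewrite expn_gt0 p_gt0.
pose unitp a := (a %/ p ^ logn p a)%N.
(* [enum_rank] turns the pair of colours into a single ordinal, as [monochromatic] requires. *)
pose c' a := enum_rank (c (logn p a), Ordinal (ltn_pmod (unitp a) pk_gt0)).
(* Divisibility by [p^(k+1)] yields the strict bound [k < t i]. *)
have [A [[A_gt0 A_mono] [a [defA Pa0 a_mod]]]] :=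
  infinite_setN0 (P_reg k.+1 _ c' isT).
have aA i : a i \in A by rewrite defA in_imfset.
have a_gt0 i : (0 < a i)%N := A_gt0 _ (aA i).
have aE i : a i = (unitp (a i) * p ^ logn p (a i))%N.
  by rewrite divnK // pfactor_dvdnn.
have col i j : c (logn p (a i)) = c (logn p (a j)) /\
    unitp (a i) = unitp (a j) %[mod p ^ k].
  by have /enum_rank_inj[] := A_mono _ _ (aA i) (aA j).
pose i0 := Ordinal n_gt0; pose u := (unitp (a i0))%:Z.
have u_co : coprimez u (p%:Z ^+ k).
  rewrite -PoszX coprimezE /= coprimeXr // coprime_sym /u.
  have [m p_m am] := pfactor_coprime p_pr (a_gt0 i0).
  by rewrite /unitp {1}am mulnK // expn_gt0 p_gt0.
(* The Bezout coefficient [v] is an inverse of [u] modulo [p^k]. *)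
have [[v q] /= vq] := coprimezP _ _ u_co.
exists [ffun i => logn p (a i)], (u, v); split => /=.
- move=> i; rewrite ffunE -pfactor_dvdn //.
  by apply/eqP; rewrite (a_mod i) mod0n.
- by move=> i j; rewrite !ffunE; case: (col i j).
- by rewrite -vq addrC modzMDl mulrC.
set t := [ffun i => _]; rewrite /approx_root.
(* Subtracting the expansion of [P(a) = 0] allows a comparison monomial by monomial. *)
have -> : \sum_(alpha <- msupp P)
      P@_alpha * p%:Z ^+ plin t alpha * u ^+ mdeg alpha =
    \sum_(alpha <- msupp P) (P@_alpha * p%:Z ^+ plin t alpha * u ^+ mdeg alpha -
      P@_alpha * \prod_i (a i)%:Z ^+ alpha i).
  by rewrite sumrB -mevalE Pa0 subr0.
apply: dvdz_sum => alpha aP.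
have -> : \prod_i (a i)%:Z ^+ alpha i =
    p%:Z ^+ plin t alpha * \prod_i (unitp (a i))%:Z ^+ alpha i.
  rewrite /plin -prodrXr -big_split /=; apply: eq_bigr => i _.
  by rewrite ffunE {1}aE PoszM PoszX exprMn mulrC exprM.
(* The factor [p^(M_0)] comes from [p^(phi alpha)], the factor [p^k] from the congruence of all unit
   parts with [u]. *)
rewrite mulrA -mulrBr exprD; apply: dvdz_mul.
  by apply: dvdz_mull; rewrite dvdz_exp2l // level0_le.
rewrite -eqz_mod_dvd mdegE -prodrXr.
elim/big_ind2: _ => // [x1 x2 y1 y2 /eqP x12 /eqP y12|i _].
  by rewrite -modzMm x12 y12 modzMm.
rewrite -modzXm -[in X in _ == X]modzXm -PoszX !modz_nat.
by have [_ ->] := col i i0.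
Qed.

(** The inverse of the unit is kept in the data so that its own p-adic limit will invert [w]. *)
Definition approx_solutions (p n : nat) (P : {mpoly int[n]}) (r : nat)
    (c : nat -> 'I_r) (k : nat) : set ({ffun 'I_n -> nat} * (int * int)) :=
  [set y : {ffun 'I_n -> nat} * (int * int) |
    [/\ forall i, (k < y.1 i)%N, forall i j, c (y.1 i) = c (y.1 j),
        (y.2.1 * y.2.2 = 1 %[mod p%:Z ^+ k])%Z &
        approx_root p P k y.1 y.2.1]]%classic.

(** The sets of approximate solutions form a filter base: the product of two colourings with the
    larger of two precisions refines both. *)
Lemma approx_solutions_ultrafilter (p n : nat) (P : {mpoly int[n]}) :
    prime p -> partition_regular p P ->
  exists G, UltraFilter G /\
    forall (r : nat) (c : nat -> 'I_r) k, G (approx_solutions p P c k).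
Proof.
move=> p_pr P_reg; pose I := ({r : nat & nat -> 'I_r} * nat)%type.
pose B (x : I) := approx_solutions p P (projT2 x.1) x.2.
have F_filter : Filter (filter_from setT B).
  apply: filter_from_filter; first by
    exists (existT (fun r => nat -> 'I_r) 1%N (fun=> ord0), 0%N).
  move=> [[r c] k] [[r' c'] k'] _ _.
  exists (existT (fun r => nat -> 'I_r) #|{: 'I_r * 'I_r'}|
    (fun a => enum_rank (c a, c' a)), maxn k k') => //.
  move=> y [/= y_gt yc /eqP]; rewrite eqz_mod_dvd => y_inv y_root.
  have cc i j : c (y.1 i) = c (y.1 j) /\ c' (y.1 i) = c' (y.1 j).
    by have /enum_rank_inj[] := yc i j.
  have le_inv j : (j <= maxn k k')%N -> (y.2.1 * y.2.2 = 1 %[mod p%:Z ^+ j])%Z.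
    move=> j_le; apply/eqP; rewrite eqz_mod_dvd.
    by apply: dvdz_trans y_inv; rewrite dvdz_exp2l.
  split; split => /=.
  - by move=> i; apply: leq_ltn_trans (y_gt i); rewrite leq_maxl.
  - by move=> i j; case: (cc i j).
  - by rewrite le_inv ?leq_maxl.
  - by apply: approx_root_le y_root; rewrite leq_maxl.
  - by move=> i; apply: leq_ltn_trans (y_gt i); rewrite leq_maxr.
  - by move=> i j; case: (cc i j).
  - by rewrite le_inv ?leq_maxr.
  - by apply: approx_root_le y_root; rewrite leq_maxr.
have F_proper : ProperFilter (filter_from setT B).
  apply: filter_from_proper => -[[r c] k] _.
  by have [t [uv tuv]] := partition_regular_approx c k p_pr P_reg; exists (t, uv).
have [G [GU FG]] := ultraFilterLemma F_proper.
by exists G; split=> // r c k; apply: FG;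
  exists (existT (fun r => nat -> 'I_r) r c, k).
Qed.

(** * Finiteness of partitions and unbounded families *)

Lemma bounded_words (V : eqType) (s : seq V) (N : nat) :
  exists L : seq (seq V),
    forall w, (size w <= N)%N -> {subset w <= s} -> w \in L.
Proof.
elim: N => [|N [L LP]]; first by exists [:: [::]] => -[].
exists ([::] :: [seq x :: w | x <- s, w <- L]) => -[//|x w] w_le w_s.
rewrite inE /=; apply/allpairsP; exists (x, w); split => //=.
  by apply: w_s; rewrite mem_head.
by apply: LP => // y yw; apply: w_s; rewrite inE yw orbT.
Qed.

(** A level partition is a word of length at most [size (msupp P)] in the finite alphabet of subsets
    of the support. *)
Lemma level_partition_finite (n : nat) (P : {mpoly int[n]}) :
  exists L : seq (seq {fset 'X_{1..n}}), forall t, level_partition P t \in L.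
Proof.
have [L LP] := bounded_words (fpowerset [fset alpha in msupp P]%fset)
  (size (msupp P)).
exists L => t; apply: LP.
  by rewrite size_map size_sort (leq_trans (size_undup _)) ?size_map.
move=> _ /mapP[M _ ->]; rewrite fpowersetE; apply/fsubsetP => alpha.
by rewrite !inE => /andP[].
Qed.

(** If [k <= f x] fails along [G], then [f] has only finitely many values there and the pigeonhole
    applies. *)
Lemma ultra_constant_or_large (T : Type) (G : set_system T) (f : T -> nat) :
    UltraFilter G ->
  (exists d, G [set x | f x = d]%classic) \/
  forall k, G [set x | (k <= f x)%N]%classic.
Proof.
move=> GU; have [|not_const] := pselect (exists d, G [set x | f x = d]%classic).
  by left.
right=> k; have [//|Gk] := in_ultra_setVsetC [set x | (k <= f x)%N]%classic GU.
case: not_const; apply: (ultra_pigeonhole (s := iota 0 k)).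
by apply: filterS Gk => x /= /negP; rewrite mem_iota -ltnNge.
Qed.

Lemma infinite_unbounded_ffun (n : nat) (A : set {ffun 'I_n -> nat}) :
    (0 < n)%N -> (forall k, exists2 t, A t & forall i, (k < t i)%N) ->
  infinite_set A.
Proof.
move=> n_gt0 A_unb /finite_seqP[s As]; pose i0 := Ordinal n_gt0.
have [t At /(_ i0)] := A_unb (\max_(t <- s) t i0)%N.
have ts : t \in s by move: At; rewrite As.
by rewrite ltnNge (leq_bigmax_seq (F := fun t : {ffun 'I_n -> nat} => t i0)).
Qed.

(** * The functional and the unit root *)

Theorem theorem3p3 (p n : nat) (P : {mpoly int[n]}) (p_prime : prime p)
    (P_neq0 : P <> 0) (P_regular : partition_regular p P) :
  exists (l m : nat) (J : l.+1.-tuple {fset 'X_{1..n}}) (d : m.-tuple nat),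
    minimal_rado_functional P J d /\
    exists w : padic_int p,
      (exists v : padic_int p, w * v = 1) /\
      \sum_(i < m.+1) (p ^ nth 0%N (0%N :: d) i)%:R *
        (\sum_(alpha <- nth fset0 J i)
           (taylor_coef P alpha)%:~R * w ^+ mdeg alpha) = 0.
Proof.
have [G [GU G_sol]] := approx_solutions_ultrafilter p_prime P_regular.
have n_gt0 := partition_regular_dim P_regular.
have p_gt0 := prime_gt0 p_prime.
have [Js GJ] : exists Js, G [set y | level_partition P y.1 = Js]%classic.
  have [L LP] := level_partition_finite P.
  by apply: (ultra_pigeonhole (s := L)); apply: filterS filterT => y _; apply: LP.
have [l Jl] : exists l, size Js == l.+1.
  have [y <-] := filter_ex GJ; exists (size (levels P y.1)).-1.
  by rewrite size_map prednK // levels_neq_nil.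
pose J := Tuple Jl.
have J_size t : level_partition P t = J -> size (levels P t) = l.+1.
  by move/(congr1 size); rewrite size_map size_tuple.
pose delta i (y : {ffun 'I_n -> nat} * (int * int)) :=
  (level P y.1 i - level P y.1 0)%N.
pose const i := exists d, G [set y | delta i y = d]%classic.
have const0 : const 0%N.
  by exists 0%N; apply: filterS filterT => y _; rewrite /= /delta subnn.
have [m [m_le const_m large_m]] : exists m, [/\ (m <= l)%N,
    forall i, (i <= m)%N -> const i &
    (m < l)%N -> forall k, G [set y | (k <= delta m.+1 y)%N]%classic].
  (* The least index that is [l.+1] or has a nonconstant difference is [m.+1]; it is not 0 by
     [const0]. The case [l.+1] gives [m = l], with no gap condition. *)
  have ex_i : exists i, (i == l.+1) || `[< ~ const i >].
    by exists l.+1; rewrite eqxx.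
  case: (ex_minnP ex_i) => -[|m]; first by case/orP=> [|/asboolP].
  move=> m_stop m_min; exists m; split.
  - by rewrite -ltnS m_min ?eqxx.
  - move=> i i_m; apply: contrapT => i_nc.
    have: (m < i)%N by apply: m_min; apply/orP; right; apply/asboolP.
    by rewrite ltnNge i_m.
  - move=> ml; case/orP: m_stop => [/eqP[ml']|/asboolP m_nc].
      by rewrite ml' ltnn in ml.
    by case: (ultra_constant_or_large (delta m.+1) GU).
have /choice[D DP] i :
    exists d, (i <= m)%N -> G [set y | delta i y = d]%classic.
  by case: (leqP i m) => [/const_m[d Gd]|_]; [exists d | exists 0%N].
(* A filter has only finite intersections, so the constants are gathered by induction up to [m]. *)
have GD : G [set y | forall i, (i <= m)%N -> delta i y = D i]%classic.
  have: forall j, (j <= m)%N ->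
      G [set y | forall i, (i <= j)%N -> delta i y = D i]%classic.
    elim=> [|j IHj] jm.
      by apply: filterS (DP 0%N jm) => y y0 i; rewrite leqn0 => /eqP ->.
    apply: filterS (filterI (IHj (ltnW jm)) (DP _ jm)) => y [yj yj1] i.
    by rewrite leq_eqVlt => /orP[/eqP -> //|]; apply: yj.
  exact.
pose d := [tuple D i.+1 | i < m].
have D0 : D 0%N = 0%N.
  by have [y <-] := filter_ex (DP 0%N isT); rewrite /delta subnn.
have dE i : (i <= m)%N -> nth 0%N (0%N :: d) i = D i.
  by case: i => [//|i] im; rewrite /= (nth_mktuple _ _ (Ordinal im)).
have level_le0 t i : size (levels P t) = l.+1 -> (i <= l)%N ->
    (level P t 0 <= level P t i)%N.
  by case: i => // i y_l il; apply/ltnW/level_lt; rewrite ?y_l.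
have G_levels k : G [set y | [/\ level_partition P y.1 = J,
    forall i, (i <= m)%N -> level P y.1 i = (level P y.1 0 + D i)%N &
    (m < l)%N -> (level P y.1 0 + k <= level P y.1 m.+1)%N]]%classic.
  have Gk : G [set y | (m < l)%N -> (k <= delta m.+1 y)%N]%classic.
    have [/large_m Gk|_] := boolP (m < l)%N; last exact: filterS filterT.
    by apply: filterS (Gk k) => y yk _; exact: yk.
  apply: filterS (filterI GJ (filterI GD Gk)) => y [/= yJ [yD yk]].
  have y_l := J_size y.1 yJ; split=> // [i im|ml].
    by rewrite -yD // subnKC // level_le0 // (leq_trans im).
  by rewrite -leq_subRL ?yk // level_le0.
exists l, m, J, d; split; first split => // [i|r c k _].
- have [y [yJ yD _]] := filter_ex (G_levels 0%N).
  rewrite tnth_mktuple -(ltn_add2l (level P y.1 0)) addn0 -yD //.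
  by apply: level_lt => //; rewrite J_size // ltnS (leq_trans _ m_le).
- apply: infinite_unbounded_ffun => // k'.
  (* [G_levels] measures the gap from [M_0]; as [M_m = M_0 + D m], adding [D m] gives a gap of [k]
     above [M_m]. *)
  have [y [[yJ yD ygap] [y_gt yc _ _]]] :=
    filter_ex (filterI (G_levels (D m + k)%N) (G_sol r c k')).
  exists y.1 => //; split => // [|i|ml].
  + split=> [_ /imfsetP[i _ ->]|_ _ /imfsetP[i _ ->] /imfsetP[j _ ->]] //.
    exact: leq_ltn_trans (y_gt i).
  + by rewrite tnth_mktuple yD // addKn.
  + have := ygap ml; rewrite addnA -yD // => gap.
    by rewrite leq_subRL // (leq_trans _ gap) ?leq_addr.
have [w wP] := padic_limit (fun y : _ * (int * int) => y.2.1) p_gt0 GU.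
have [v vP] := padic_limit (fun y : _ * (int * int) => y.2.2) p_gt0 GU.
exists w; split.
  exists v; apply: padicP => k.
  (* Only the congruence matters here, so a single colour suffices. *)
  have [y [[yw yv] [_ _ y_inv _]]] :=
    filter_ex (filterI (filterI (wP k) (vP k)) (G_sol 1%N (fun=> ord0) k)).
  have -> : (w * v) k = ((y.2.1 * y.2.2) %% p%:Z ^+ k)%Z by exact: residue_ofM.
  by rewrite y_inv.
apply: padicP => k.
(* One point [y] both represents [w] modulo [p^k] and solves the truncated equation modulo [p^k]. *)
have [y [[yw [yJ yD ygap]] [_ _ _ y_root]]] :=
  filter_ex (filterI (filterI (wP k) (G_levels k)) (G_sol 1%N (fun=> ord0) k)).
have := @approx_root_levels p n P k m d y.1 y.2.1 p_gt0.
rewrite (J_size _ yJ) ltnS => /(_ m_le _ ygap y_root).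
rewrite yJ; set F := \sum_(i < _) _ => F_dvd.
have F_res : residue_of k (\sum_(i < m.+1) (p ^ nth 0%N (0%N :: d) i)%:R *
    (\sum_(alpha <- nth fset0 J i)
       (taylor_coef P alpha)%:~R * w ^+ mdeg alpha)) F.
  apply: residue_of_sum => i; apply: residue_ofM; first exact: residue_of_nat.
  apply: residue_of_sum => alpha; apply: residue_ofM; last exact: residue_ofX.
  exact: residue_of_int.
rewrite F_res; apply/eqP; rewrite eqz_mod_dvd subr0.
by apply: F_dvd => i im; rewrite dE // yD.
Qed.
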